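(* Let $A\in\mathbb{R}^{d\times n}$ have columns $a_1,\dots,a_n\in\mathbb{R}^d$, let $f:\mathbb{R}^d\to\mathbb{R}$ be a closed convex function, and let $\triangle=\{x\in\mathbb{R}^n : x_i\ge 0,\ \sum_{i=1}^n x_i=1\}$ be the unit simplex. Consider the problem $\min_{x\in\triangle} f(Ax)$ and let $(x^\star,w^\star)\in\mathbb{R}^n\times\mathbb{R}^d$ be an optimal primal-dual pair. Then for every $i\in\{1,\dots,n\}$, $$(a_i-Ax^\star)^\top w^\star>0\ \Longrightarrow\ x_i^\star=0 .$$
   Context: The constrained problem $\min_{x\in\mathcal{C}}f(Ax)$ is viewed as $\min_x f(Ax)+g(x)$ with $g=\iota_{\mathcal{C}}$ the indicator function of $\mathcal{C}$ ($0$ on $\mathcal{C}$, $+\infty$ outside); its dual is $\min_{w\in\mathbb{R}^d} f^*(w)+g^*(-A^\top w)$, where $h^*(v)=\sup_u v^\top u-h(u)$. An optimal primal-dual pair $(x^\star,w^\star)$ is a pair satisfying the first-order optimality conditions $w^\star\in\partial f(Ax^\star)$, $Ax^\star\in\partial f^*(w^\star)$, $-A^\top w^\star\in\partial g(x^\star)$, $x^\star\in\partial g^*(-A^\top w^\star)$. *)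

(* Defs.v *)
From HB Require Import structures.
From mathcomp Require Import all_boot all_order all_algebra.
From mathcomp Require Import all_classical all_reals all_analysis.

Set Implicit Arguments.
Unset Strict Implicit.
Unset Printing Implicit Defensive.

Import Order.TTheory GRing.Theory Num.Theory.
Import numFieldNormedType.Exports.

Local Open Scope classical_set_scope.
Local Open Scope ring_scope.

Definition dot (R : realType) (m : nat) (u v : 'cV[R]_m) : R :=
  (u^T *m v) 0 0.

Definition closed_function (R : realType) (m : nat) (h : 'cV[R]_m -> R) : Prop :=
  closed [set p : 'cV[R]_m * R | h p.1 <= p.2].

Definition unit_simplex (R : realType) (n : nat) : set 'cV[R]_n :=
  [set x | (forall i, 0 <= x i 0) /\ \sum_i x i 0 = 1].

(* Convex-analytic indicator (0 on C, +oo outside), not the library's 0/1-valued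
   indicator \1_C. *)
Definition cvx_indicator (R : realType) (m : nat) (C : set 'cV[R]_m)
    (x : 'cV[R]_m) : \bar R :=
  if x \in C then 0%E else +oo%E.

Definition fconj (R : realType) (m : nat) (h : 'cV[R]_m -> \bar R)
    (v : 'cV[R]_m) : \bar R :=
  ereal_sup [set ((dot v u)%:E - h u)%E | u in [set: 'cV[R]_m]].

(* For h proper, the inequality forces h x < +oo, so that the subdifferential is
   empty outside the effective domain of h. *)
Definition subdifferential (R : realType) (m : nat) (h : 'cV[R]_m -> \bar R)
    (x : 'cV[R]_m) : set 'cV[R]_m :=
  [set s | forall y : 'cV[R]_m, (h x + (dot s (y - x))%:E <= h y)%E].

(* Optimal primal-dual pair for min_x f(Ax) + g(x) and its dual
   min_w f^*(w) + g^*(-A^T w). *)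
Definition optimal_pair (R : realType) (d n : nat) (A : 'M[R]_(d, n))
    (f : 'cV[R]_d -> \bar R) (g : 'cV[R]_n -> \bar R)
    (x : 'cV[R]_n) (w : 'cV[R]_d) : Prop :=
  [/\ subdifferential f (A *m x) w,
      subdifferential (fconj f) w (A *m x),
      subdifferential g x (- (A^T *m w)) &
      subdifferential (fconj g) (- (A^T *m w)) x].

(* Main.v *)
(* Testing the inclusion [- A^T w \in \partial g(x)] at the vertices of the
   simplex gives [(a_j - A x)^T w >= 0] for all [j].  The average of these
   numbers with weights [x_j] is [(A x - A x)^T w = 0], so each product
   [x_j (a_j - A x)^T w] vanishes. *)

Require Import Defs.
From HB Require Import structures.
From mathcomp Require Import all_boot all_order all_algebra.
From mathcomp Require Import all_classical all_reals all_analysis.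

Set Implicit Arguments.
Unset Strict Implicit.
Unset Printing Implicit Defensive.

Import Order.TTheory GRing.Theory Num.Theory.
Import numFieldNormedType.Exports.

Local Open Scope classical_set_scope.
Local Open Scope ring_scope.

Lemma dotC (R : realType) (m : nat) (u v : 'cV[R]_m) : dot u v = dot v u.
Proof. by rewrite /dot -[u^T *m v]trmxK trmx_mul trmxK mxE. Qed.

Lemma dotNl (R : realType) (m : nat) (u v : 'cV[R]_m) :
  dot (- u) v = - dot u v.
Proof. by rewrite /dot linearN mulNmx mxE. Qed.

Lemma dotBl (R : realType) (m : nat) (u v w : 'cV[R]_m) :
  dot (u - v) w = dot u w - dot v w.
Proof. by rewrite /dot linearB mulmxBl !mxE. Qed.

Lemma dot_mulmx (R : realType) (d n : nat) (A : 'M[R]_(d, n))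
    (x : 'cV[R]_n) (w : 'cV[R]_d) :
  dot (A *m x) w = dot (A^T *m w) x.
Proof. by rewrite dotC /dot trmx_mul trmxK mulmxA. Qed.

(** Both sides are the coordinate expansion of [dot (A^T *m w) x], as coordinate [j] of [A^T *m w]
    is [dot (col j A) w]. *)
Lemma sum_dot_col (R : realType) (d n : nat) (A : 'M[R]_(d, n))
    (x : 'cV[R]_n) (w : 'cV[R]_d) :
  \sum_j x j 0 * dot (col j A) w = dot (A *m x) w.
Proof.
rewrite dot_mulmx /dot mxE; apply: eq_bigr => j _.
by rewrite mulrC tr_col -row_mul !mxE.
Qed.

Lemma unit_simplex_delta (R : realType) (n : nat) (i : 'I_n) :
  unit_simplex (delta_mx i 0 : 'cV[R]_n).
Proof.
split=> [j|]; first by rewrite mxE ler0n.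
rewrite (bigD1 i) //= mxE !eqxx big1 ?addr0 // => j /negbTE ji.
by rewrite mxE ji.
Qed.

(** Subgradients of the indicator are normal vectors to [C]: between two points of [C] both
    indicator values are 0, and only the linear term is left. *)
Lemma cvx_indicator_subdifferentialP (R : realType) (m : nat)
    (C : set 'cV[R]_m) (x s : 'cV[R]_m) :
  C !=set0 -> subdifferential (cvx_indicator C) x s ->
  C x /\ forall y, C y -> dot s (y - x) <= 0.
Proof.
move=> [y0 Cy0] sub.
have Cx : C x.
  move: (sub y0); rewrite /cvx_indicator (mem_set Cy0).
  (* Outside [C] the inequality at [y0] would read [+oo <= 0]. *)
  by case: ifPn => [/set_mem//|_]; rewrite addye // leye_eq.
split=> // y Cy; move: (sub y).
by rewrite /cvx_indicator (mem_set Cx) (mem_set Cy) add0e lee_fin.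
Qed.

Theorem theorem6 (R : realType) (d n : nat) (A : 'M[R]_(d, n))
    (f : 'cV[R]_d -> R)
    (f_closed : closed_function f)
    (f_convex : @convex_function R 'cV[R]_d setT f)
    (x : 'cV[R]_n) (w : 'cV[R]_d)
    (xw_opt : optimal_pair A (EFin \o f) (cvx_indicator (@unit_simplex R n)) x w)
    (i : 'I_n) :
  0 < dot (col i A - A *m x) w -> x i 0 = 0.
Proof.
move=> ci_gt0; case: xw_opt => _ _ sub _.
(* The simplex is empty when [n = 0]; here the index [i] provides a vertex. *)
have [[x_ge0 x_sum1] le0] := cvx_indicator_subdifferentialP
  (ex_intro _ _ (@unit_simplex_delta R n i)) sub.
pose c j := dot (col j A - A *m x) w.
have c_ge0 j : 0 <= c j.
  (* As [col j A] is [A *m delta_mx j 0], [c j] is the pairing of [A^T *m w] with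
     [delta_mx j 0 - x], the opposite of what [le0] bounds. *)
  rewrite /c colE -mulmxBr dot_mulmx -oppr_le0 -dotNl.
  exact/le0/unit_simplex_delta.
have avg0 : \sum_j x j 0 * c j = 0.
  under eq_bigr do rewrite /c dotBl mulrBr.
  by rewrite sumrB sum_dot_col -mulr_suml x_sum1 mul1r subrr.
have /(_ i isT)/eqP := psumr_eq0P (fun j _ => mulr_ge0 (x_ge0 j) (c_ge0 j)) avg0.
by rewrite mulf_eq0 (gt_eqF ci_gt0) orbF => /eqP.
Qed.
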